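(* The horospherical map $$H:\mathfrak{H}\times\mathbb{R}_{>0}\to\mathcal{S},\qquad H(z,t,r)=\left(\frac{-|z|^2-r+it}{2},\;z\right),$$ is a holomorphic isometric mapping between the Kähler manifolds $(\mathfrak{H}\times\mathbb{R}_{>0},\mathbb{I},g',\Omega')$ and the complex hyperbolic plane $\mathbf{H}^2_{\mathbb{C}}$ (the Siegel domain $\mathcal{S}$) endowed with the Bergman metric.
   Context: $\mathfrak{H}=\mathbb{C}\times\mathbb{R}$ is the Heisenberg group with coordinates $(z=x+iy,t)$ and multiplication $(z,t)*(w,s)=(z+w,t+s+2\Im(z\overline w))$. Put $X=\partial_x+2y\,\partial_t$, $Y=\partial_y-2x\,\partial_t$, $T=\partial_t$, $\omega=dt+2x\,dy-2y\,dx=dt+2\Im(\overline z\,dz)$. On $\mathfrak{H}\times\mathbb{R}_{>0}$ with coordinates $(z,t,r)$: the complex structure $\mathbb{I}$ is given by $\mathbb{I}X=Y$, $\mathbb{I}Y=-X$, $\mathbb{I}T=\partial_r$, $\mathbb{I}\partial_r=-T$; the metric is $g'=\frac{4}{r}(dx^2+dy^2)+\frac{1}{r^2}(\omega^2+dr^2)$; the fundamental form is $\Omega'=\frac{4}{r}dx\wedge dy+\frac{1}{r^2}\omega\wedge dr$. The Siegel domain is $\mathcal{S}=\{(z_1,z_2)\in\mathbb{C}^2:\rho(z_1,z_2)>0\}$, where $\rho(z_1,z_2)=-2\Re(z_1)-|z_2|^2$, with its standard complex structure. The complex hyperbolic plane $\mathbf{H}^2_{\mathbb{C}}$ is $\mathcal{S}$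 with the Bergman metric $ds^2=\frac{4}{\rho}|dz_2|^2+\frac{4}{\rho^2}|dz_1+\overline{z_2}\,dz_2|^2$. ''Holomorphic isometric'' means that $H$ is holomorphic with respect to $\mathbb{I}$ and the standard complex structure of $\mathcal{S}\subset\mathbb{C}^2$, and $H^*ds^2=g'$. *)

(* Defs.v *)
From Stdlib Require Export Reals.
From Coquelicot Require Export Coquelicot.
Set Implicit Arguments.
Open Scope R_scope.

(** * Differential geometry on an open subset of a vector space

    [V] and [W] are meant to be finite-dimensional.  A tangent vector at a
    point of an open set [D] of [V] is identified with an element of [V], so
    vector fields are maps [V -> V] and tensors are families of multilinear
    maps indexed by the base point.  Every map is total; only its values on
    [D] matter. *)

Section OpenSets.
Context {V W : NormedModule R_AbsRing}.

Definition is_ddir (f : V -> W) (p u : V) (l : W) : Prop :=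
  is_derive (fun s : R => f (plus p (scal s u))) 0 l.

(** In finite dimension, having all directional derivatives of class C^n
    on the open set [D] is the same as being of class C^(n+1) on [D]. *)
Fixpoint class_C (n : nat) (D : V -> Prop) (f : V -> W) : Prop :=
  match n with
  | O => forall p, D p -> continuous f p
  | S m => forall u : V, exists f' : V -> W,
      (forall p, D p -> is_ddir f p u (f' p)) /\ class_C m D f'
  end.

Definition smooth_on (D : V -> Prop) (f : V -> W) : Prop :=
  forall n, class_C n D f.

End OpenSets.

Section Kahler.
Context {V : NormedModule R_AbsRing}.

(** [l] is the value at [p] of the Lie bracket [[A, B] = dB(A) - dA(B)]. *)
Definition is_lie_bracket (A B : V -> V) (p l : V) : Prop :=
  exists a b, is_ddir B p (A p) a /\ is_ddir A p (B p) b /\ l = minus a b.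

(** Vanishing at [p] of the Nijenhuis tensor
    [N(u,v) = [u,v] + J [Ju,v] + J [u,Jv] - [Ju,Jv]].  As [N] is a tensor, it
    is computed with [u] and [v] extended to constant vector fields, for which
    [[u,v] = 0]. *)
Definition nijenhuis_zero (J : V -> V -> V) (p : V) : Prop :=
  forall u v, exists l1 l2 l3,
    is_lie_bracket (fun q => J q u) (fun _ => v) p l1 /\
    is_lie_bracket (fun _ => u) (fun q => J q v) p l2 /\
    is_lie_bracket (fun q => J q u) (fun q => J q v) p l3 /\
    minus (plus (J p l1) (J p l2)) l3 = zero.

Definition ddir_R (f : V -> R) (p u : V) : R :=
  Derive (fun s => f (plus p (scal s u))) 0.

(** Exterior derivative of a 2-form, evaluated on constant vector fields. *)
Definition ext_d2 (Om : V -> V -> V -> R) (p u v w : V) : R :=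
  ddir_R (fun q => Om q v w) p u - ddir_R (fun q => Om q u w) p v
  + ddir_R (fun q => Om q u v) p w.

End Kahler.

(** An open set with an endomorphism field, a bilinear form field and a
    2-form; [is_kahler] says when these form a Kähler structure. *)
Record hermitian_data (V : NormedModule R_AbsRing) := HermitianData {
  dom : V -> Prop;
  cplx : V -> V -> V;
  metric : V -> V -> V -> R;
  fform : V -> V -> V -> R
}.

Section KahlerManifolds.
Context {V : NormedModule R_AbsRing}.

Record is_almost_hermitian (M : hermitian_data V) : Prop := {
  dom_open : open (dom M);
  cplx_smooth : forall v, smooth_on (dom M) (fun p => cplx M p v);
  metric_smooth : forall u v,
    smooth_on (W := R_NormedModule) (dom M) (fun p => metric M p u v);
  fform_smooth : forall u v,
    smooth_on (W := R_NormedModule) (dom M) (fun p => fform M p u v);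
  cplx_linear : forall p, dom M p -> is_linear (cplx M p);
  cplx_square : forall p, dom M p -> forall u, cplx M p (cplx M p u) = opp u;
  metric_linear : forall p, dom M p -> forall u,
    is_linear (V := R_NormedModule) (metric M p u);
  metric_sym : forall p, dom M p -> forall u v, metric M p u v = metric M p v u;
  metric_pos : forall p, dom M p -> forall u, u <> zero -> 0 < metric M p u u;
  metric_cplx : forall p, dom M p -> forall u v,
    metric M p (cplx M p u) (cplx M p v) = metric M p u v;
  fform_eq : forall p, dom M p -> forall u v,
    fform M p u v = metric M p (cplx M p u) v
}.

Record is_kahler (M : hermitian_data V) : Prop := {
  kahler_hermitian : is_almost_hermitian M;
  cplx_integrable : forall p, dom M p -> nijenhuis_zero (cplx M) p;
  fform_closed : forall p, dom M p -> forall u v w, ext_d2 (fform M) p u v w = 0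
}.

End KahlerManifolds.

Section Maps.
Context {V W : NormedModule R_AbsRing}.
Variables (M : hermitian_data V) (N : hermitian_data W) (f : V -> W).

Definition is_smooth_map : Prop :=
  (forall p, dom M p -> dom N (f p)) /\ smooth_on (dom M) f.

Definition is_holomorphic_map : Prop :=
  forall p, dom M p -> exists df : V -> W,
    filterdiff f (locally p) df /\
    forall u, df (cplx M p u) = cplx N (f p) (df u).

(** The pull-back by [f] of the metric of [N] is the metric of [M]. *)
Definition is_isometric_map : Prop :=
  forall p, dom M p -> exists df : V -> W,
    filterdiff f (locally p) df /\
    forall u v, metric N (f p) (df u) (df v) = metric M p u v.

Definition is_holomorphic_isometric_map : Prop :=
  is_smooth_map /\ is_holomorphic_map /\ is_isometric_map.

End Maps.

(** * The product of the Heisenberg group and the half-line *)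

Definition heisenberg : Type := (C * R)%type.

(** [heisenberg * R] as a real vector space: the points are [(z, t, r)], and
    the tangent vectors are written in the coordinates (x + iy, t, r). *)
Definition heisR : NormedModule R_AbsRing :=
  prod_NormedModule R_AbsRing
    (prod_NormedModule R_AbsRing C_R_NormedModule R_NormedModule)
    R_NormedModule.

Definition cz (p : heisenberg * R) : C := fst (fst p).
Definition cx (p : heisenberg * R) : R := Re (cz p).
Definition cy (p : heisenberg * R) : R := Im (cz p).
Definition ct (p : heisenberg * R) : R := snd (fst p).
Definition cr (p : heisenberg * R) : R := snd p.

Definition vX (p : heisR) : heisR := ((1, 0), 2 * cy p, 0).
Definition vY (p : heisR) : heisR := ((0, 1), - 2 * cx p, 0).
Definition vT (p : heisR) : heisR := ((0, 0), 1, 0).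
Definition vR (p : heisR) : heisR := ((0, 0), 0, 1).

Definition dx (p u : heisR) : R := cx u.
Definition dy (p u : heisR) : R := cy u.
Definition dt (p u : heisR) : R := ct u.
Definition dr (p u : heisR) : R := cr u.
Definition omega (p u : heisR) : R :=
  dt p u + 2 * cx p * dy p u - 2 * cy p * dx p u.

Definition wedge (a b : heisR -> heisR -> R) (p u v : heisR) : R :=
  a p u * b p v - a p v * b p u.

(** [(dx, dy, omega, dr)] is the coframe dual to the frame
    [(vX, vY, vT, vR)]. *)
Lemma frame_decomposition (p u : heisR) :
  u = plus (plus (plus (scal (dx p u) (vX p)) (scal (dy p u) (vY p)))
                 (scal (omega p u) (vT p))) (scal (dr p u) (vR p)).
Proof.
destruct p as [[[x y] t] r], u as [[[a b] c] d].
change (NormedModule.sort R_AbsRing R_NormedModule) with R in *.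
repeat apply injective_projections; cbv -[Rplus Rmult Ropp IZR];
  match goal with |- @eq _ ?a ?b => change (@eq R a b) end; ring.
Qed.

Definition heis_cplx (p u : heisR) : heisR :=
  plus (plus (plus (scal (dx p u) (vY p)) (scal (dy p u) (opp (vX p))))
             (scal (omega p u) (vR p))) (scal (dr p u) (opp (vT p))).

Lemma heis_cplx_frame (p : heisR) :
  heis_cplx p (vX p) = vY p /\ heis_cplx p (vY p) = opp (vX p) /\
  heis_cplx p (vT p) = vR p /\ heis_cplx p (vR p) = opp (vT p).
Proof.
destruct p as [[[x y] t] r].
change (NormedModule.sort R_AbsRing R_NormedModule) with R in *.
repeat split; repeat apply injective_projections;
  cbv -[Rplus Rmult Ropp IZR];
  match goal with |- @eq _ ?a ?b => change (@eq R a b) end; ring.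
Qed.

Definition heis_metric (p u v : heisR) : R :=
  4 / cr p * (dx p u * dx p v + dy p u * dy p v)
  + 1 / cr p ^ 2 * (omega p u * omega p v + dr p u * dr p v).

Definition heis_fform (p u v : heisR) : R :=
  4 / cr p * wedge dx dy p u v + 1 / cr p ^ 2 * wedge omega dr p u v.

Definition heis_kahler : hermitian_data heisR :=
  HermitianData heisR (fun p : heisR => 0 < cr p) heis_cplx heis_metric heis_fform.

(** * The complex hyperbolic plane *)

Definition C2 : NormedModule R_AbsRing :=
  prod_NormedModule R_AbsRing C_R_NormedModule C_R_NormedModule.

Definition rho (q : C * C) : R := - 2 * Re (fst q) - Cmod (snd q) ^ 2.

Definition siegel (q : C2) : Prop := 0 < rho q.

Definition std_cplx (q u : C2) : C2 := (Ci * fst u, Ci * snd u)%C.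

(** Polarisation of [4/rho |dz2|^2 + 4/rho^2 |dz1 + conj z2 dz2|^2]. *)
Definition bergman (q u v : C2) : R :=
  let theta (w : C2) := (fst w + Cconj (snd q) * snd w)%C in
  4 / rho q * Re (snd u * Cconj (snd v))%C
  + 4 / rho q ^ 2 * Re (theta u * Cconj (theta v))%C.

(** The fundamental form is normalised as [g(Ju, v)], the convention satisfied
    by [heis_fform]: it is [4/r] on [(vX, vY)] and [1/r^2] on [(vT, vR)]. *)
Definition complex_hyperbolic_plane : hermitian_data C2 :=
  HermitianData C2 siegel std_cplx bergman
    (fun q u v => bergman q (std_cplx q u) v).

(** * The horospherical map *)

Definition horospherical (p : heisR) : C2 :=
  ((- RtoC (Cmod (cz p) ^ 2) - RtoC (cr p) + Ci * RtoC (ct p)) / 2, cz p)%C.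

(* Main.v *)
From Stdlib Require Import Lra.
Require Import Defs.

(** In the coordinates (z, t, r) the defining function of the Siegel domain
    satisfies rho(H(z, t, r)) = r, and the complex 1-form
    theta = dz1 + conj(z2) dz2 of the Bergman metric pulls back under H to
    (- dr + i omega) / 2.  Since moreover z2 = z, substituting these values in
    [4/rho |dz2|^2 + 4/rho^2 |theta|^2] gives
    [4/r |dz|^2 + 1/r^2 (omega^2 + dr^2)], which is the isometry statement.
    The complex structure [heis_cplx] acts on dx + i dy and on - dr + i omega as
    multiplication by i, just as the standard one does on dz2 and theta; hence
    H is holomorphic.

    Both Kähler structures are verified directly, by the same computation on
    the two sides.  The two fundamental forms have the shape
    [4/f alpha /\ beta + m/f^2 sigma /\ tau], where alpha and beta are
    constant 1-forms, f is polynomial of degree at most 2, and sigma, tau have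
    coefficients of degree at most 1; [is_derive_form] differentiates such an
    expression along a line.  Closedness holds because the derivative of f is
    proportional to one of sigma and tau, and the exterior derivative of the
    other one is a multiple of [alpha /\ beta] which compensates the
    derivative of [4/f].  Integrability is clear for the constant complex
    structure of C^2; on the Heisenberg side the complex structure is affine in
    the base point, which gives its Lie brackets exactly.

    All the tensors have coefficients that are rational functions of the
    coordinates.  Smoothness is therefore obtained once and for all from the
    fact that rational functions are continuous and stable under
    differentiation ([rational_smooth]), and the same calculus gives the
    Fréchet differential of H from its directional derivatives
    ([rational_filterdiff_ddir]). *)

(** * Directional derivatives *)

Lemma is_derive_line {V : NormedModule R_AbsRing} (a k : V) (x : R) :
  is_derive (fun s : R => plus a (scal s k)) x k.
Proof.
assert (H : is_derive (fun s : R => plus a (scal s k)) x (plus zero (scal one k))).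
{ apply (is_derive_plus (fun _ => a) (fun s : R => scal s k)).
  - exact (is_derive_const a x).
  - exact (is_derive_scal_l (fun s : R => s) x one k (is_derive_id x)). }
now rewrite plus_zero_l, scal_one in H.
Qed.

Section DirectionalDerivatives.
Context {V W : NormedModule R_AbsRing}.

Lemma is_ddir_filterdiff (f lf : V -> W) (p u : V) :
  filterdiff f (locally p) lf -> is_ddir f p u (lf u).
Proof.
intros Hf.
assert (Hp : plus p (scal 0 u) = p).
{ transitivity (plus p zero); [|apply plus_zero_r].
  f_equal; exact (scal_zero_l u). }
rewrite <- Hp in Hf.
unfold is_ddir, is_derive.
apply filterdiff_ext_lin with (fun s : R_AbsRing => lf (scal s u)).
- exact (filterdiff_comp' (fun s : R_AbsRing => plus p (scal s u)) f 0 _ lf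
           (is_derive_line p u 0) Hf).
- intros s; apply linear_scal, Hf.
Qed.

Lemma is_ddir_affine (f : V -> W) (p u : V) (k : W) :
  (forall s : R, f (plus p (scal s u)) = plus (f p) (scal s k)) ->
  is_ddir f p u k.
Proof.
intros E; apply (is_derive_ext (fun s : R => plus (f p) (scal s k))).
{ intros s; symmetry; apply E. }
apply is_derive_line.
Qed.

Lemma is_ddir_const (a : W) (p u : V) :
  is_ddir (fun _ => a) p u zero.
Proof. exact (is_derive_const a 0). Qed.

End DirectionalDerivatives.

Lemma lie_bracket_ddir {V : NormedModule R_AbsRing} (A B : V -> V) (p a b : V) :
  is_ddir B p (A p) a -> is_ddir A p (B p) b -> is_lie_bracket A B p (minus a b).
Proof. intros; now exists a, b. Qed.

(** * Rational functions are smooth *)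

Section Rational.
Context {V : NormedModule R_AbsRing}.

(** The last constructor lets functions be recognised through a formula in
    coordinates without appealing to functional extensionality. *)
Inductive rational_on (D : V -> Prop) : (V -> R) -> Prop :=
| rational_const c : rational_on D (fun _ => c)
| rational_linear (l : V -> R) :
    is_linear (V := R_NormedModule) l -> rational_on D l
| rational_plus f g :
    rational_on D f -> rational_on D g -> rational_on D (fun p => f p + g p)
| rational_mult f g :
    rational_on D f -> rational_on D g -> rational_on D (fun p => f p * g p)
| rational_inv f :
    rational_on D f -> (forall p, D p -> f p <> 0) -> rational_on D (fun p => / f p)
| rational_ext f g :
    (forall p, f p = g p) -> rational_on D f -> rational_on D g.

Lemma rational_opp D f : rational_on D f -> rational_on D (fun p => - f p).
Proof.
intros Hf; apply rational_ext with (fun p => (-1) * f p); [intros; ring|].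
apply rational_mult; [apply rational_const | exact Hf].
Qed.

Lemma rational_pow D f n : rational_on D f -> rational_on D (fun p => f p ^ n).
Proof.
intros Hf; induction n as [|n IH]; simpl.
- apply rational_const.
- now apply rational_mult.
Qed.

(** The induction that drives the calculus: the sum, product and inverse rules
    for the Fréchet differential only produce rational functions again. *)
Lemma rational_filterdiff (D : V -> Prop) (f : V -> R) :
  rational_on D f ->
  exists f' : V -> V -> R,
    (forall p, D p -> filterdiff (V := R_NormedModule) f (locally p) (f' p)) /\
    (forall u, rational_on D (fun p => f' p u)).
Proof.
intros Hf; induction Hf as
  [c | l Hl | f g _ [f' [Df Rf]] _ [g' [Dg Rg]] | f g Hf [f' [Df Rf]] Hg [g' [Dg Rg]]
  | f Hf [f' [Df Rf]] nz | f g E _ [f' [Df Rf]]].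
- exists (fun _ _ => 0); split; [intros p _|intros u; apply rational_const].
  apply (filterdiff_const (V := R_NormedModule)).
- exists (fun _ => l); split; [intros p _|intros u; apply rational_const].
  now apply filterdiff_linear.
- exists (fun p u => f' p u + g' p u); split; [intros p Dp|intros u].
  + exact (filterdiff_plus_fct _ _ _ _ (Df p Dp) (Dg p Dp)).
  + now apply rational_plus.
- exists (fun p u => f' p u * g p + f p * g' p u); split; [intros p Dp|intros u].
  + exact (filterdiff_mult_fct f g p _ _ Rmult_comm (Df p Dp) (Dg p Dp)).
  + apply rational_plus; apply rational_mult; auto.
- exists (fun p u => f' p u * (- (/ f p * / f p))); split; [intros p Dp|intros u].
  + assert (Hinv : is_derive Rinv (f p) (- (/ f p * / f p))).
    { auto_derive; [now apply nz | field; now apply nz]. }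
    exact (filterdiff_comp' f Rinv p _ _ (Df p Dp) Hinv).
  + apply rational_mult; [apply Rf|].
    apply rational_opp, rational_mult; now apply rational_inv.
- exists f'; split; [intros p Dp|exact Rf].
  exact (filterdiff_ext _ _ _ E (Df p Dp)).
Qed.

Lemma rational_continuous (D : V -> Prop) (f : V -> R) (p : V) :
  rational_on D f -> D p -> continuous f p.
Proof.
intros Hf Dp; destruct (rational_filterdiff _ _ Hf) as [f' [Df _]].
apply (filterdiff_continuous (V := R_NormedModule)).
exists (f' p); now apply Df.
Qed.

(** A class of continuous functions that is stable under directional
    derivatives consists of smooth functions, by induction on the order. *)
Lemma rational_smooth (D : V -> Prop) (f : V -> R) :
  rational_on D f -> smooth_on (W := R_NormedModule) D f.
Proof.
intros Hf n; revert f Hf; induction n as [|n IH]; intros f Hf.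
- intros p Dp; now apply (rational_continuous D).
- destruct (rational_filterdiff _ _ Hf) as [f' [Df Rf]].
  intros u; exists (fun p => f' p u); split; [|now apply IH].
  intros p Dp; apply is_ddir_filterdiff; now apply Df.
Qed.

(** Directional derivatives can be computed on a single real variable; they
    determine the Fréchet differential of a function known to have one. *)
Lemma rational_filterdiff_ddir (D : V -> Prop) (f : V -> R) (p : V) (l : V -> R) :
  rational_on D f -> D p ->
  (forall u, is_ddir (W := R_NormedModule) f p u (l u)) ->
  filterdiff (V := R_NormedModule) f (locally p) l.
Proof.
intros Hf Dp Hl; destruct (rational_filterdiff _ _ Hf) as [f' [Df _]].
apply filterdiff_ext_lin with (f' p); [now apply Df|].
intros u; transitivity (ddir_R f p u).
- symmetry; apply is_derive_unique, is_ddir_filterdiff, Df, Dp.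
- apply is_derive_unique, Hl.
Qed.

Lemma rational_open_pos (f : V -> R) :
  rational_on (fun _ => True) f -> open (fun p => 0 < f p).
Proof.
intros Hf; apply (open_comp f (fun x => 0 < x)); [|apply open_gt].
intros p _; now apply (rational_continuous (fun _ => True)).
Qed.

End Rational.

Ltac rational_coords :=
  repeat first
    [ apply rational_const | assumption
    | apply rational_opp | apply rational_plus
    | apply rational_pow | apply rational_mult | apply rational_inv ].

(** * Maps into a product *)

Lemma filterdiff_pair {V W1 W2 : NormedModule R_AbsRing}
    (f lf : V -> W1) (g lg : V -> W2) (p : V) :
  filterdiff f (locally p) lf -> filterdiff g (locally p) lg ->
  filterdiff (V := prod_NormedModule R_AbsRing W1 W2)
    (fun q => (f q, g q)) (locally p) (fun u => (lf u, lg u)).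
Proof.
intros Hf Hg.
apply (filterdiff_comp'_2 (W := prod_NormedModule R_AbsRing W1 W2)
         f g (fun a b => (a, b)) p lf lg (fun a b => (a, b)) Hf Hg).
apply filterdiff_linear, is_linear_prod; [apply is_linear_fst|apply is_linear_snd].
Qed.

Lemma smooth_on_pair {V W1 W2 : NormedModule R_AbsRing}
    (D : V -> Prop) (f : V -> W1) (g : V -> W2) :
  smooth_on D f -> smooth_on D g ->
  smooth_on (W := prod_NormedModule R_AbsRing W1 W2) D (fun q => (f q, g q)).
Proof.
intros Hf Hg n.
generalize (Hf n) (Hg n); clear Hf Hg; revert f g.
induction n as [|n IH]; intros f g Hf Hg.
- intros p Dp.
  apply (continuous_comp_2 f g (fun a b => (a, b)) p (Hf p Dp) (Hg p Dp)).
  apply (continuous_ext (fun x => x)); [now intros []|apply continuous_id].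
- intros u; destruct (Hf u) as [f' [Df Cf]], (Hg u) as [g' [Dg Cg]].
  exists (fun q => (f' q, g' q)); split; [|now apply IH].
  intros p Dp.
  exact (filterdiff_pair _ _ _ _ _ (Df p Dp) (Dg p Dp)).
Qed.

Lemma smooth_on_ext {V W : NormedModule R_AbsRing} (D : V -> Prop) (f g : V -> W) :
  (forall p, f p = g p) -> smooth_on D f -> smooth_on D g.
Proof.
intros E Hf [|n].
- intros p Dp; now apply (continuous_ext f g p E), (Hf O).
- intros u; destruct (Hf (S n) u) as [f' [Df Cf]].
  exists f'; split; [|exact Cf].
  intros p Dp; apply (is_derive_ext (fun s => f (plus p (scal s u)))).
  + intros s; apply E.
  + now apply Df.
Qed.

(** * Linear forms, and 2-forms of the common shape *)

Lemma is_linear_Rmult {V : NormedModule R_AbsRing} (c : R) (l : V -> R) :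
  is_linear (V := R_NormedModule) l ->
  is_linear (V := R_NormedModule) (fun u => c * l u).
Proof.
intros Hl.
exact (is_linear_comp l (fun x : R_NormedModule => scal c x) Hl
         (is_linear_scal_r (V := R_NormedModule) c Rmult_comm)).
Qed.

Lemma is_linear_Rplus {V : NormedModule R_AbsRing} (l m : V -> R) :
  is_linear (V := R_NormedModule) l -> is_linear (V := R_NormedModule) m ->
  is_linear (V := R_NormedModule) (fun u => l u + m u).
Proof.
intros Hl Hm.
exact (is_linear_comp _ _ (is_linear_prod l m Hl Hm)
         (is_linear_plus (V := R_NormedModule))).
Qed.

Lemma weighted_sum_le_0 {a b s t : R} :
  0 < a -> 0 < b -> 0 <= s -> 0 <= t -> a * s + b * t <= 0 -> s = 0 /\ t = 0.
Proof.
intros Ha Hb Hs Ht H.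
assert (0 <= a * s) by (apply Rmult_le_pos; lra).
assert (0 <= b * t) by (apply Rmult_le_pos; lra).
split; [destruct (Rmult_integral a s) | destruct (Rmult_integral b t)]; lra.
Qed.

(** The restriction to a line of either fundamental form, evaluated on constant
    vector fields: [r + s * r1 + s ^ 2 * r2] is the conformal factor, [k] the
    value of [alpha /\ beta], and the affine functions are the values of
    [sigma] and [tau] on the two vectors. *)
Lemma is_derive_form (m k r r1 r2 A A1 B B1 C C1 D D1 : R) :
  r <> 0 ->
  is_derive (fun s : R =>
      4 / (r + s * r1 + s ^ 2 * r2) * k
      + m / (r + s * r1 + s ^ 2 * r2) ^ 2
        * ((A + s * A1) * (D + s * D1) - (B + s * B1) * (C + s * C1))) 0
    (- 4 * r1 / r ^ 2 * k - 2 * m * r1 / r ^ 3 * (A * D - B * C)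
     + m / r ^ 2 * (A1 * D + A * D1 - B1 * C - B * C1)).
Proof.
intros Hr; auto_derive.
- replace (r + 0 * r1 + 0 * (0 * 1) * r2) with r by ring.
  repeat split; trivial; exact (pow_nonzero r 2 Hr).
- field; exact Hr.
Qed.

(** * The Kähler structure on the product of the Heisenberg group and the half-line *)

Lemma is_linear_cz : is_linear (V := C_R_NormedModule) (cz : heisR -> C).
Proof. exact (is_linear_comp _ _ is_linear_fst is_linear_fst). Qed.

Lemma is_linear_cx : is_linear (U := heisR) (V := R_NormedModule) cx.
Proof. exact (is_linear_comp _ _ is_linear_cz is_linear_fst). Qed.

Lemma is_linear_cy : is_linear (U := heisR) (V := R_NormedModule) cy.
Proof. exact (is_linear_comp _ _ is_linear_cz is_linear_snd). Qed.

Lemma is_linear_ct : is_linear (U := heisR) (V := R_NormedModule) ct.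
Proof. exact (is_linear_comp _ _ is_linear_fst is_linear_snd). Qed.

Lemma is_linear_cr : is_linear (U := heisR) (V := R_NormedModule) cr.
Proof. exact is_linear_snd. Qed.

Ltac rational_heis :=
  repeat first
    [ apply (rational_linear _ _ is_linear_cx) | apply (rational_linear _ _ is_linear_cy)
    | apply (rational_linear _ _ is_linear_ct) | apply (rational_linear _ _ is_linear_cr)
    | progress rational_coords ].

Ltac linear_heis :=
  pose proof is_linear_cx; pose proof is_linear_cy;
  pose proof is_linear_ct; pose proof is_linear_cr;
  repeat first [assumption | apply @is_linear_Rplus | apply @is_linear_Rmult].

(* Until points and vectors are broken into real numbers, [ring] does not
   recognise the operations of the normed modules. *)
Ltac heis_ring :=
  repeat match goal with p : NormedModule.sort _ heisR |- _ =>
    destruct p as [[[? ?] ?] ?] end;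
  unfold heis_metric, heis_fform, wedge, omega, dx, dy, dt, dr, cx, cy, cz, ct, cr,
    Re, Im, Rdiv; cbn;
  change (NormedModule.sort R_AbsRing R_NormedModule) with R in *;
  match goal with |- @eq _ ?a ?b => change (@eq R a b) end; ring.

Lemma heisR_eq (u v : heisR) :
  cx u = cx v -> cy u = cy v -> ct u = ct v -> cr u = cr v -> u = v.
Proof.
destruct u as [[[a b] c] d], v as [[[a' b'] c'] d'].
unfold cx, cy, cz, ct, cr; simpl; congruence.
Qed.

Lemma heis_cplxE (p u : heisR) :
  heis_cplx p u =
  ((- cy u, cx u),
   - 2 * cx p * cx u - 2 * cy p * cy u - cr u,
   ct u + 2 * cx p * cy u - 2 * cy p * cx u).
Proof.
apply heisR_eq; unfold heis_cplx; heis_ring.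
Qed.

Lemma heis_cplx_smooth D v : smooth_on D (fun p => heis_cplx p v).
Proof.
apply (smooth_on_ext _ _ _ (fun p => eq_sym (heis_cplxE p v))).
repeat apply @smooth_on_pair; apply rational_smooth; rational_heis.
Qed.

Lemma heis_metric_smooth u v :
  smooth_on (W := R_NormedModule) (dom heis_kahler) (fun p => heis_metric p u v).
Proof.
apply rational_smooth; unfold heis_metric, omega, dx, dy, dt, dr.
rational_heis; intros p Hp; apply Rgt_not_eq; try apply pow_lt; exact Hp.
Qed.

Lemma heis_fform_smooth u v :
  smooth_on (W := R_NormedModule) (dom heis_kahler) (fun p => heis_fform p u v).
Proof.
apply rational_smooth; unfold heis_fform, wedge, omega, dx, dy, dt, dr.
rational_heis; intros p Hp; apply Rgt_not_eq; try apply pow_lt; exact Hp.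
Qed.

Lemma heis_cplx_linear p : is_linear (heis_cplx p).
Proof.
apply (is_linear_ext (fun u : heisR =>
  ((- 1 * cy u, cx u),
   - 2 * cx p * cx u + (- 2 * cy p * cy u + -1 * cr u),
   ct u + (2 * cx p * cy u + - 2 * cy p * cx u)) : heisR)).
{ intros u; rewrite heis_cplxE.
  apply heisR_eq; heis_ring. }
repeat apply @is_linear_prod; linear_heis.
Qed.

Lemma heis_hermitian : is_almost_hermitian heis_kahler.
Proof.
split; cbn [dom cplx metric fform heis_kahler].
- apply (rational_open_pos cr); rational_heis.
- intros v; apply heis_cplx_smooth.
- exact heis_metric_smooth.
- exact heis_fform_smooth.
- intros p _; apply heis_cplx_linear.
- intros p _ u; rewrite !heis_cplxE.
  apply heisR_eq; heis_ring.
- intros p _ u.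
  apply (is_linear_ext (fun v : heisR =>
     (4 / cr p * dx p u + 1 / cr p ^ 2 * omega p u * (- 2 * cy p)) * cx v +
     ((4 / cr p * dy p u + 1 / cr p ^ 2 * omega p u * (2 * cx p)) * cy v +
     (1 / cr p ^ 2 * omega p u * ct v +
      1 / cr p ^ 2 * dr p u * cr v)) : R_NormedModule)).
  { intros v; unfold heis_metric, omega, dx, dy, dt, dr.
    match goal with |- @eq _ ?a ?b => change (@eq R a b) end; ring. }
  linear_heis.
- intros p _ u v; unfold heis_metric; ring.
- intros p Hp u Hu; unfold heis_metric.
  assert (P1 : 0 < 4 / cr p) by (apply Rdiv_lt_0_compat; [lra|exact Hp]).
  assert (P2 : 0 < 1 / cr p ^ 2) by (apply Rdiv_lt_0_compat; [lra|now apply pow_lt]).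
  apply Rnot_le_lt; intros Hle; apply Hu.
  destruct (weighted_sum_le_0 P1 P2
              (Rplus_le_le_0_compat _ _ (Rle_0_sqr (dx p u)) (Rle_0_sqr (dy p u)))
              (Rplus_le_le_0_compat _ _ (Rle_0_sqr (omega p u)) (Rle_0_sqr (dr p u)))
              Hle) as [Hh Hv].
  destruct (Rplus_sqr_eq_0 _ _ Hh) as [Hdx Hdy].
  destruct (Rplus_sqr_eq_0 _ _ Hv) as [Hom Hdr].
  revert Hom; unfold omega; rewrite Hdx, Hdy; intros Hom.
  apply heisR_eq; [exact Hdx | exact Hdy | unfold dt in Hom; cbn; lra | exact Hdr].
- intros p _ u v; rewrite !heis_cplxE.
  heis_ring.
- intros p _ u v; rewrite heis_cplxE.
  heis_ring.
Qed.

(** The right-hand side is that of [is_derive_form] for [m = 1]; the trivial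
    terms are the derivatives of the constant coefficients of [dr]. *)
Lemma heis_fform_ddir (p u v w : heisR) :
  0 < cr p ->
  ddir_R (fun q => heis_fform q v w) p u =
  - 4 * cr u / cr p ^ 2 * (cx v * cy w - cx w * cy v)
  - 2 * 1 * cr u / cr p ^ 3 * (omega p v * cr w - omega p w * cr v)
  + 1 / cr p ^ 2 * (2 * (cx u * cy v - cy u * cx v) * cr w + omega p v * 0
                  - 2 * (cx u * cy w - cy u * cx w) * cr v - omega p w * 0).
Proof.
intros Hp; apply is_derive_unique.
eapply is_derive_ext; [|apply (is_derive_form _ _ _ _ 0); lra].
intros s; cbv beta.
replace (cr p + s * cr u + s ^ 2 * 0) with (cr (plus p (scal s u)))
  by (change (cr (plus p (scal s u))) with (cr p + s * cr u); ring).
heis_ring.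
Qed.

(** Here [f = r], [sigma = omega] and [tau = dr], and
    [d omega = 4 dx /\ dy] compensates [d (4/r) = - 4/r^2 dr]. *)
Lemma heis_fform_closed (p u v w : heisR) :
  0 < cr p -> ext_d2 heis_fform p u v w = 0.
Proof.
intros Hp; unfold ext_d2; rewrite !heis_fform_ddir by exact Hp.
unfold omega, dx, dy, dt; field; lra.
Qed.

(** [heis_cplx q w] is affine in [q], and this is the value at [u] of its
    linear part. *)
Definition heis_cplx_var (u w : heisR) : heisR :=
  ((0, 0), - 2 * (cx u * cx w + cy u * cy w), 2 * (cx u * cy w - cy u * cx w)).

Lemma heis_cplx_ddir (p u w : heisR) :
  is_ddir (fun q => heis_cplx q w) p u (heis_cplx_var u w).
Proof.
apply is_ddir_affine; intros s; rewrite !heis_cplxE.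
apply heisR_eq; unfold heis_cplx_var; heis_ring.
Qed.

Lemma heis_integrable (p : heisR) : nijenhuis_zero heis_cplx p.
Proof.
intros u v.
exists (minus zero (heis_cplx_var v u)), (minus (heis_cplx_var u v) zero),
  (minus (heis_cplx_var (heis_cplx p u) v) (heis_cplx_var (heis_cplx p v) u)).
split; [|split; [|split]].
- exact (lie_bracket_ddir (fun q => heis_cplx q u) (fun _ => v) p _ _
           (is_ddir_const v p _) (heis_cplx_ddir p v u)).
- exact (lie_bracket_ddir (fun _ => u) (fun q => heis_cplx q v) p _ _
           (heis_cplx_ddir p u v) (is_ddir_const u p _)).
- exact (lie_bracket_ddir (fun q => heis_cplx q u) (fun q => heis_cplx q v) p _ _
           (heis_cplx_ddir p _ v) (heis_cplx_ddir p _ u)).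
- rewrite !heis_cplxE.
  apply heisR_eq; unfold heis_cplx_var; heis_ring.
Qed.

Lemma heis_is_kahler : is_kahler heis_kahler.
Proof.
split.
- exact heis_hermitian.
- intros p _; apply heis_integrable.
- intros p Hp u v w; now apply heis_fform_closed.
Qed.

(** * The Kähler structure of the complex hyperbolic plane *)

Lemma Cmod_sqr (z : C) : Cmod z ^ 2 = Re z ^ 2 + Im z ^ 2.
Proof.
unfold Cmod; rewrite <- Rsqr_pow2, Rsqr_sqrt; [reflexivity|].
apply Rplus_le_le_0_compat; apply pow2_ge_0.
Qed.

Definition z1x (q : C2) : R := Re (fst q).
Definition z1y (q : C2) : R := Im (fst q).
Definition z2x (q : C2) : R := Re (snd q).
Definition z2y (q : C2) : R := Im (snd q).

(** The real and imaginary parts of the form dz1 + conj(z2) dz2 at [q]. *)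
Definition theta_re (q w : C2) : R := z1x w + z2x q * z2x w + z2y q * z2y w.
Definition theta_im (q w : C2) : R := z1y w + z2x q * z2y w - z2y q * z2x w.

Lemma is_linear_z1x : is_linear (U := C2) (V := R_NormedModule) z1x.
Proof. exact (is_linear_comp _ _ (is_linear_fst (U := C_R_NormedModule)) is_linear_fst). Qed.
Lemma is_linear_z1y : is_linear (U := C2) (V := R_NormedModule) z1y.
Proof. exact (is_linear_comp _ _ (is_linear_fst (U := C_R_NormedModule)) is_linear_snd). Qed.
Lemma is_linear_z2x : is_linear (U := C2) (V := R_NormedModule) z2x.
Proof. exact (is_linear_comp _ _ (is_linear_snd (V := C_R_NormedModule)) is_linear_fst). Qed.
Lemma is_linear_z2y : is_linear (U := C2) (V := R_NormedModule) z2y.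
Proof. exact (is_linear_comp _ _ (is_linear_snd (V := C_R_NormedModule)) is_linear_snd). Qed.

Ltac rational_C2 :=
  repeat first
    [ apply (rational_linear _ _ is_linear_z1x) | apply (rational_linear _ _ is_linear_z1y)
    | apply (rational_linear _ _ is_linear_z2x) | apply (rational_linear _ _ is_linear_z2y)
    | assumption | progress rational_coords ].

Ltac linear_C2 :=
  pose proof is_linear_z1x; pose proof is_linear_z1y;
  pose proof is_linear_z2x; pose proof is_linear_z2y;
  repeat first [assumption | apply @is_linear_Rplus | apply @is_linear_Rmult].

Ltac C2_ring :=
  repeat match goal with p : NormedModule.sort _ C2 |- _ =>
    destruct p as [[? ?] [? ?]] end;
  unfold theta_re, theta_im, z1x, z1y, z2x, z2y, std_cplx, Re, Im, Rdiv; cbn;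
  change (NormedModule.sort R_AbsRing R_NormedModule) with R in *;
  match goal with |- @eq _ ?a ?b => change (@eq R a b) end; ring.

Lemma C2_eq (u v : C2) :
  z1x u = z1x v -> z1y u = z1y v -> z2x u = z2x v -> z2y u = z2y v -> u = v.
Proof.
destruct u as [[a b] [c d]], v as [[a' b'] [c' d']].
unfold z1x, z1y, z2x, z2y; simpl; congruence.
Qed.

Lemma rhoE q : rho q = - 2 * z1x q - (z2x q ^ 2 + z2y q ^ 2).
Proof. unfold rho; rewrite Cmod_sqr; reflexivity. Qed.

Lemma bergmanE q u v :
  bergman q u v =
  4 / rho q * (z2x u * z2x v + z2y u * z2y v)
  + 4 / rho q ^ 2 * (theta_re q u * theta_re q v + theta_im q u * theta_im q v).
Proof.
unfold bergman, Rdiv; generalize (/ rho q) (/ rho q ^ 2); intros; C2_ring.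
Qed.

(** The form [theta_q] is complex linear, so the fundamental form is
    [4/rho dx2 /\ dy2 + 4/rho^2 theta_re /\ theta_im]. *)
Lemma siegel_fformE q u v :
  bergman q (std_cplx q u) v =
  4 / rho q * (z2x u * z2y v - z2y u * z2x v)
  + 4 / rho q ^ 2 * (theta_re q u * theta_im q v - theta_im q u * theta_re q v).
Proof.
rewrite bergmanE; unfold Rdiv; generalize (/ rho q) (/ rho q ^ 2); intros; C2_ring.
Qed.

Lemma rational_rho D : rational_on (V := C2) D rho.
Proof.
apply (rational_ext _ _ _ (fun q => eq_sym (rhoE q))); rational_C2.
Qed.

Lemma bergman_smooth u v :
  smooth_on (W := R_NormedModule) siegel (fun q : C2 => bergman q u v).
Proof.
apply rational_smooth.
apply (rational_ext _ _ _ (fun q => eq_sym (bergmanE q u v))).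
unfold theta_re, theta_im; pose proof (rational_rho siegel).
rational_C2; intros q Hq; apply Rgt_not_eq; try apply pow_lt; exact Hq.
Qed.

Lemma std_cplx_linear q : is_linear (std_cplx q).
Proof.
apply (is_linear_ext (fun u : C2 => ((- 1 * z1y u, z1x u), (- 1 * z2y u, z2x u)) : C2)).
{ intros u; apply C2_eq; C2_ring. }
apply @is_linear_prod; apply @is_linear_prod; linear_C2.
Qed.

Lemma siegel_hermitian : is_almost_hermitian complex_hyperbolic_plane.
Proof.
split; cbn [dom cplx metric fform complex_hyperbolic_plane].
- apply (rational_open_pos (V := C2)), rational_rho.
- intros v; apply (smooth_on_ext siegel (fun _ : C2 =>
      ((- 1 * z1y v, z1x v), (- 1 * z2y v, z2x v)) : C2)).
  { intros q; apply C2_eq; C2_ring. }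
  repeat apply @smooth_on_pair; apply rational_smooth, rational_const.
- exact bergman_smooth.
- intros u v; apply (bergman_smooth (std_cplx zero u) v).
- intros q _; apply std_cplx_linear.
- intros q _ u; apply C2_eq; C2_ring.
- intros q _ u.
  apply (is_linear_ext (fun v : C2 =>
    4 / rho q ^ 2 * theta_re q u * z1x v + (4 / rho q ^ 2 * theta_im q u * z1y v
    + ((4 / rho q * z2x u + 4 / rho q ^ 2 * (theta_re q u * z2x q - theta_im q u * z2y q)) * z2x v
    + (4 / rho q * z2y u + 4 / rho q ^ 2 * (theta_re q u * z2y q + theta_im q u * z2x q)) * z2y v))
    : R_NormedModule)).
  { intros v; rewrite bergmanE; unfold Rdiv;
    generalize (/ rho q) (/ rho q ^ 2); intros; C2_ring. }
  linear_C2.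
- intros q _ u v; rewrite !bergmanE; ring.
- intros q Hq u Hu; rewrite bergmanE.
  assert (P1 : 0 < 4 / rho q) by (apply Rdiv_lt_0_compat; [lra|exact Hq]).
  assert (P2 : 0 < 4 / rho q ^ 2) by (apply Rdiv_lt_0_compat; [lra|now apply pow_lt]).
  apply Rnot_le_lt; intros Hle; apply Hu.
  destruct (weighted_sum_le_0 P1 P2
              (Rplus_le_le_0_compat _ _ (Rle_0_sqr (z2x u)) (Rle_0_sqr (z2y u)))
              (Rplus_le_le_0_compat _ _ (Rle_0_sqr (theta_re q u)) (Rle_0_sqr (theta_im q u)))
              Hle) as [Hz Ht].
  destruct (Rplus_sqr_eq_0 _ _ Hz) as [Hx Hy].
  destruct (Rplus_sqr_eq_0 _ _ Ht) as [Hre Him].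
  unfold theta_re, theta_im in Hre, Him; rewrite Hx, Hy in Hre, Him.
  apply C2_eq; [cbn; lra | cbn; lra | exact Hx | exact Hy].
- intros q _ u v; rewrite !bergmanE; unfold Rdiv.
  generalize (/ rho q) (/ rho q ^ 2); intros; C2_ring.
- reflexivity.
Qed.

Lemma siegel_fform_ddir (p u v w : C2) :
  0 < rho p ->
  ddir_R (fun q => bergman q (std_cplx q v) w) p u =
  - 4 * (- 2 * theta_re p u) / rho p ^ 2 * (z2x v * z2y w - z2y v * z2x w)
  - 2 * 4 * (- 2 * theta_re p u) / rho p ^ 3
    * (theta_re p v * theta_im p w - theta_im p v * theta_re p w)
  + 4 / rho p ^ 2 *
    ((z2x u * z2x v + z2y u * z2y v) * theta_im p w
     + theta_re p v * (z2x u * z2y w - z2y u * z2x w)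
     - (z2x u * z2y v - z2y u * z2x v) * theta_re p w
     - theta_im p v * (z2x u * z2x w + z2y u * z2y w)).
Proof.
intros Hp; apply is_derive_unique.
eapply is_derive_ext;
  [|apply (is_derive_form _ _ _ _ (- (z2x u ^ 2 + z2y u ^ 2))); lra].
intros s; cbv beta; rewrite siegel_fformE.
replace (rho p + s * (- 2 * theta_re p u) + s ^ 2 * (- (z2x u ^ 2 + z2y u ^ 2)))
  with (rho (plus p (scal s u))) by (rewrite !rhoE; C2_ring).
(* Matching the coefficients by conversion keeps the inverse of [rho] out of
   the ring identity. *)
apply (f_equal2 Rplus); apply (f_equal2 Rmult); try reflexivity; C2_ring.
Qed.

(** Here [d rho = - 2 theta_re] and [d theta_im = 2 dx2 /\ dy2], while
    [theta_re] is closed. *)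
Lemma siegel_fform_closed (p u v w : C2) :
  0 < rho p -> ext_d2 (fun q u v => bergman q (std_cplx q u) v) p u v w = 0.
Proof.
intros Hp; unfold ext_d2; rewrite !siegel_fform_ddir by exact Hp.
unfold theta_re, theta_im; field; lra.
Qed.

Lemma siegel_is_kahler : is_kahler complex_hyperbolic_plane.
Proof.
split.
- exact siegel_hermitian.
- intros p _ u v.
  exists (minus zero zero), (minus zero zero), (minus zero zero).
  split; [|split; [|split]];
    [apply (lie_bracket_ddir (fun _ : C2 => std_cplx p u) (fun _ => v));
       [exact (is_ddir_const v p _)|exact (is_ddir_const (std_cplx p u) p _)]
    |apply (lie_bracket_ddir (fun _ : C2 => u) (fun _ => std_cplx p v));
       [exact (is_ddir_const (std_cplx p v) p _)|exact (is_ddir_const u p _)]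
    |apply (lie_bracket_ddir (fun _ : C2 => std_cplx p u) (fun _ => std_cplx p v));
       [exact (is_ddir_const (std_cplx p v) p _)|exact (is_ddir_const (std_cplx p u) p _)]
    |].
  apply C2_eq; C2_ring.
- intros p Hp u v w; now apply siegel_fform_closed.
Qed.

(** * The horospherical map *)

Lemma horosphericalE (p : heisR) :
  horospherical p =
  ((- (cx p ^ 2 + cy p ^ 2 + cr p) / 2, ct p / 2), (cx p, cy p)).
Proof.
unfold horospherical; rewrite Cmod_sqr.
apply C2_eq; unfold z1x, z1y, z2x, z2y, cx, cy; cbn; try reflexivity; field.
Qed.

Definition horospherical_diff (p u : heisR) : C2 :=
  ((- (cx p * cx u + cy p * cy u) - cr u / 2, ct u / 2), (cx u, cy u)).

Lemma horospherical_smooth D : smooth_on D horospherical.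
Proof.
apply (smooth_on_ext _ _ _ (fun p => eq_sym (horosphericalE p))).
repeat apply @smooth_on_pair; apply rational_smooth; rational_heis; intros; lra.
Qed.

Lemma horospherical_filterdiff (p : heisR) :
  filterdiff horospherical (locally p) (horospherical_diff p).
Proof.
apply (filterdiff_ext _ _ _ (fun q => eq_sym (horosphericalE q))).
unfold horospherical_diff.
repeat apply @filterdiff_pair.
- apply (rational_filterdiff_ddir (fun _ => True)); trivial.
  + rational_heis; intros; lra.
  + intros u.
    apply (is_derive_ext (fun s : R =>
      - ((cx p + s * cx u) ^ 2 + (cy p + s * cy u) ^ 2 + (cr p + s * cr u)) / 2)).
    * reflexivity.
    * auto_derive; [trivial | field].
- apply (rational_filterdiff_ddir (fun _ => True)); trivial.
  + rational_heis; intros; lra.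
  + intros u; apply (is_derive_ext (fun s : R => (ct p + s * ct u) / 2)).
    * reflexivity.
    * auto_derive; [trivial | field].
- apply filterdiff_linear, is_linear_cx.
- apply filterdiff_linear, is_linear_cy.
Qed.

Lemma rho_horospherical (p : heisR) : rho (horospherical p) = cr p.
Proof. rewrite rhoE, horosphericalE; unfold z1x, z2x, z2y; cbn; field. Qed.

(** With the next lemma: theta pulls back to (- dr + i omega) / 2. *)
Lemma theta_re_horospherical_diff (p u : heisR) :
  theta_re (horospherical p) (horospherical_diff p u) = - dr p u / 2.
Proof.
rewrite horosphericalE.
unfold theta_re, horospherical_diff, z1x, z2x, z2y, dr; cbn; field.
Qed.

Lemma theta_im_horospherical_diff (p u : heisR) :
  theta_im (horospherical p) (horospherical_diff p u) = omega p u / 2.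
Proof.
rewrite horosphericalE.
unfold theta_im, horospherical_diff, z1y, z2x, z2y, omega, dt, dx, dy; cbn; field.
Qed.

Theorem theorem6p2 :
  is_kahler heis_kahler /\
  is_kahler complex_hyperbolic_plane /\
  is_holomorphic_isometric_map heis_kahler complex_hyperbolic_plane horospherical.
Proof.
split; [exact heis_is_kahler|split; [exact siegel_is_kahler|]].
split; [|split].
- split; [|apply horospherical_smooth].
  intros p Hp; cbn; unfold siegel; now rewrite rho_horospherical.
- intros p _; exists (horospherical_diff p); split; [apply horospherical_filterdiff|].
  intros u; cbn [cplx heis_kahler complex_hyperbolic_plane]; rewrite heis_cplxE.
  apply C2_eq;
    unfold horospherical_diff, std_cplx, z1x, z1y, z2x, z2y, cx, cy, cz, ct, cr;
    cbn; field.
- intros p Hp; exists (horospherical_diff p); split; [apply horospherical_filterdiff|].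
  intros u v; cbn [metric heis_kahler complex_hyperbolic_plane].
  rewrite bergmanE, rho_horospherical, !theta_re_horospherical_diff,
    !theta_im_horospherical_diff.
  unfold heis_metric, z2x, z2y, dx, dy; cbn; field; apply Rgt_not_eq; exact Hp.
Qed.
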